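(* Let $m\ge1$. A pair $r\in\mathcal P^{(m)}(1,\circ\bullet)$, $s\in\mathcal P^{(m)}(1,\bullet\circ)$ of spatial partitions on $m$ levels satisfies the conjugate equations $$(r^*\otimes\mathrm{id}_\circ)\cdot(\mathrm{id}_\circ\otimes s)=\mathrm{id}_\circ,\qquad (s^*\otimes\mathrm{id}_\bullet)\cdot(\mathrm{id}_\bullet\otimes r)=\mathrm{id}_\bullet$$ if and only if there is a permutation $\sigma\in S_m$ such that $r=\sigma_{\circ\bullet}$ and $s=(\sigma^{-1})_{\bullet\circ}$.
   Context: $\{\circ,\bullet\}^*$ is the free monoid of finite words in two colours with empty word $1$; $|x|$ is the length and $x_i$ the $i$-th letter of $x$. For $m\ge1$, $\mathcal P^{(m)}(x,y)$ is the set of spatial partitions on $m$ levels with upper colours $x$ and lower colours $y$, i.e. set partitions (into blocks) of $\{1,\dots,|x|+|y|\}\times\{1,\dots,m\}$; points $(i,j)$ with $i\le|x|$ are upper points of colour $x_i$, points $(|x|+i,j)$ are lower points of colour $y_i$, and $j$ is the level. Tensor product $p\otimes q\in\mathcal P^{(m)}(xw,yz)$ of $p\in\mathcal P^{(m)}(x,y)$, $q\in\mathcal P^{(m)}(w,z)$: place $q$ to the right of $p$. Involution $p^*\in\mathcal P^{(m)}(y,x)$: swap upper and lower points. Composition $p\cdot q\in\mathcal P^{(m)}(x,z)$ of $p\in\mathcal P^{(m)}(y,z)$, $q\in\mathcal P^{(m)}(x,y)$: identify each lower point of $q$ with the corresponding upper point of $p$, merge blocks sharing identified points, delete the identified points and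 any resulting empty blocks. $\mathrm{id}_x\in\mathcal P^{(m)}(x,x)$ is the partition with blocks $\{(i,j),(|x|+i,j)\}$ for $1\le i\le |x|$, $1\le j\le m$. For $\sigma\in S_m$ and colours $a,b\in\{\circ,\bullet\}$, $\sigma_{ab}\in\mathcal P^{(m)}(1,ab)$ is the partition with blocks $\{(1,i),(2,\sigma(i))\}$, $1\le i\le m$. *)

(* Defs.v *)
From mathcomp Require Import all_boot all_fingroup.

Set Implicit Arguments.
Unset Strict Implicit.
Unset Printing Implicit Defensive.

(* White stands for the hollow circle and Black for the bullet. *)
Inductive color := White | Black.

(* The colour of the point (i, j) is the i-th letter of x ++ y: it depends only
   on the indices x and y, so a partition carries no further colour data. *)
Definition point (m : nat) (x y : seq color) : finType :=
  ('I_(size x + size y) * 'I_m)%type.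

Definition upper m x y (i : 'I_(size x)) (j : 'I_m) : point m x y :=
  (lshift (size y) i, j).

Definition lower m x y (i : 'I_(size y)) (j : 'I_m) : point m x y :=
  (rshift (size x) i, j).

Definition spart (m : nat) (x y : seq color) :=
  {P : {set {set point m x y}} | partition P [set: point m x y]}.

(* The map sending an upper point (i, j) to (f i, j) and a lower point
   (|x| + i, j) to (g i, j). *)
Definition relabel m x y (I : Type) (f : 'I_(size x) -> I)
    (g : 'I_(size y) -> I) (u : point m x y) : I * 'I_m :=
  (match split u.1 with inl i => f i | inr i => g i end, u.2).

Lemma relabel_inj m x y (I : Type) (f : 'I_(size x) -> I)
    (g : 'I_(size y) -> I) :
  injective f -> injective g -> (forall i k, f i <> g k) ->
  injective (relabel (m := m) f g).
Proof.
move=> injf injg fg [a j] [b k]; rewrite /relabel /= => -[+ ->].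
rewrite -{2}(splitK a) -{2}(splitK b).
case: (split a) => i; case: (split b) => i' /=.
- by move/injf->.
- by move/fg.
- by move/esym/fg.
- by move/injg->.
Qed.

Lemma partitionTI (T : finType) (P : {set {set T}}) :
  set0 \notin P ->
  (forall u, exists2 B, B \in P & u \in B) ->
  (forall A B u, A \in P -> B \in P -> u \in A -> u \in B -> A = B) ->
  partition P [set: T].
Proof.
move=> P0 Pcov Puniq; apply/and3P; split=> //.
  apply/eqP/setP=> u; rewrite inE; apply/bigcupP.
  by have [B PB uB] := Pcov u; exists B.
apply/trivIsetP=> A B PA PB neqAB; rewrite -setI_eq0; apply/eqP/setP=> u.
rewrite !inE; apply/negP=> /andP[uA uB].
by case/eqP: neqAB; apply: Puniq uA uB.
Qed.

Lemma partitionTE (T : finType) (P : {set {set T}}) :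
  partition P [set: T] ->
  [/\ set0 \notin P, forall u, exists2 B, B \in P & u \in B &
      forall A B u, A \in P -> B \in P -> u \in A -> u \in B -> A = B].
Proof.
case/and3P=> /eqP Pcov Ptriv P0; split=> // [u|A B u PA PB uA uB].
  have: u \in cover P by rewrite Pcov inE.
  by case/bigcupP=> B PB uB; exists B.
by rewrite -(def_pblock Ptriv PA uA) (def_pblock Ptriv PB uB).
Qed.

Definition catl (x w : seq color) (i : 'I_(size x)) : 'I_(size (x ++ w)) :=
  cast_ord (esym (size_cat x w)) (lshift (size w) i).

Definition catr (x w : seq color) (i : 'I_(size w)) : 'I_(size (x ++ w)) :=
  cast_ord (esym (size_cat x w)) (rshift (size x) i).

Definition tensorl m x y w z : point m x y -> point m (x ++ w) (y ++ z) :=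
  relabel (fun i => lshift _ (catl w i)) (fun i => rshift _ (catl z i)).

Definition tensorr m x y w z : point m w z -> point m (x ++ w) (y ++ z) :=
  relabel (fun i => lshift _ (catr x i)) (fun i => rshift _ (catr y i)).

Definition tensor_blocks m x y w z (p : spart m x y) (q : spart m w z) :
    {set {set point m (x ++ w) (y ++ z)}} :=
  [set @tensorl m x y w z @: B | B : {set point m x y} in val p] :|:
  [set @tensorr m x y w z @: B | B : {set point m w z} in val q].

Lemma lrshiftP n k (i : 'I_n) (j : 'I_k) : lshift k i <> rshift n j.
Proof. by move/eqP; rewrite eq_lrshift. Qed.

Lemma tensorl_inj m x y w z : injective (@tensorl m x y w z).
Proof.
apply: relabel_inj=> [i j|i j|i j]; last exact: lrshiftP.
  by move/lshift_inj/cast_ord_inj/lshift_inj.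
by move/rshift_inj/cast_ord_inj/lshift_inj.
Qed.

Lemma tensorr_inj m x y w z : injective (@tensorr m x y w z).
Proof.
apply: relabel_inj=> [i j|i j|i j]; last exact: lrshiftP.
  by move/lshift_inj/cast_ord_inj/rshift_inj.
by move/rshift_inj/cast_ord_inj/rshift_inj.
Qed.

Lemma tensorlr m x y w z (u : point m x y) (v : point m w z) :
  tensorl w z u <> tensorr x y v.
Proof.
rewrite /tensorl /tensorr /relabel => -[+ _].
case: (split u.1) => i; case: (split v.1) => k.
- by move/lshift_inj/cast_ord_inj/lrshiftP.
- by move/lrshiftP.
- by move/esym/lrshiftP.
- by move/rshift_inj/cast_ord_inj/lrshiftP.
Qed.

Lemma tensor_cover m x y w z (u : point m (x ++ w) (y ++ z)) :
  (exists v : point m x y, u = tensorl w z v) \/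
  (exists v : point m w z, u = tensorr x y v).
Proof.
case: u => a j; rewrite -(splitK a); case: (split a) => i /=.
  rewrite -(cast_ordK (size_cat x w) i) -(splitK (cast_ord _ i)).
  case: (split _) => k /=.
    by left; exists (upper y k j); rewrite /tensorl /relabel /= (unsplitK (inl _)).
  by right; exists (upper z k j); rewrite /tensorr /relabel /= (unsplitK (inl _)).
rewrite -(cast_ordK (size_cat y z) i) -(splitK (cast_ord _ i)).
case: (split _) => k /=.
  by left; exists (lower x k j); rewrite /tensorl /relabel /= (unsplitK (inr _)).
by right; exists (lower w k j); rewrite /tensorr /relabel /= (unsplitK (inr _)).
Qed.

Lemma tensor_partition m x y w z (p : spart m x y) (q : spart m w z) :
  partition (tensor_blocks p q) [set: point m (x ++ w) (y ++ z)].
Proof.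
have [p0 pcov puniq] := partitionTE (valP p).
have [q0 qcov quniq] := partitionTE (valP q).
apply: partitionTI.
- rewrite inE; apply/norP; split; apply/imsetP=> -[B PB /esym/eqP].
    by rewrite imset_eq0 => /eqP B0; move: p0; rewrite -B0 PB.
  by rewrite imset_eq0 => /eqP B0; move: q0; rewrite -B0 PB.
- move=> u; case: (tensor_cover u) => -[v ->].
    have [B PB vB] := pcov v; exists (tensorl w z @: B); last exact: imset_f.
    by rewrite inE imset_f.
  have [B PB vB] := qcov v; exists (@tensorr m x y w z @: B); last exact: imset_f.
  by rewrite inE [X in _ || X]imset_f ?orbT.
- move=> A B u; rewrite !inE => /orP[]/imsetP[A' PA ->] /orP[]/imsetP[B' PB ->].
  + case/imsetP=> a aA -> /imsetP[b bB /tensorl_inj eab]; subst b.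
    by rewrite (puniq _ _ _ PA PB aA bB).
  + by case/imsetP=> a _ -> /imsetP[b _ /tensorlr].
  + by case/imsetP=> a _ -> /imsetP[b _ /esym/tensorlr].
  + case/imsetP=> a aA -> /imsetP[b bB /tensorr_inj eab]; subst b.
    by rewrite (quniq _ _ _ PA PB aA bB).
Qed.

Definition tensor m x y w z (p : spart m x y) (q : spart m w z) :
    spart m (x ++ w) (y ++ z) :=
  exist _ (tensor_blocks p q) (tensor_partition p q).

Definition flip m x y : point m x y -> point m y x :=
  relabel (fun i => rshift (size y) i) (fun i => lshift (size x) i).

Definition star_blocks m x y (p : spart m x y) : {set {set point m y x}} :=
  [set @flip m x y @: B | B : {set point m x y} in val p].

Lemma flip_inj m x y : injective (@flip m x y).
Proof.
apply: relabel_inj=> [i j /rshift_inj //|i j /lshift_inj //|i j].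
by move/esym/lrshiftP.
Qed.

Lemma flipK m x y : cancel (@flip m x y) (@flip m y x).
Proof.
case=> a j; rewrite /flip /relabel /=; rewrite -{2}(splitK a).
by case: (split a) => i; rewrite ?(unsplitK (inl _)) ?(unsplitK (inr _)).
Qed.

Lemma star_partition m x y (p : spart m x y) :
  partition (star_blocks p) [set: point m y x].
Proof.
have [p0 pcov puniq] := partitionTE (valP p).
apply: partitionTI.
- apply/imsetP=> -[B PB /esym/eqP].
  by rewrite imset_eq0 => /eqP B0; move: p0; rewrite -B0 PB.
- move=> u; have [B PB uB] := pcov (flip u).
  exists (@flip m x y @: B); first exact: imset_f.
  by apply/imsetP; exists (flip u); rewrite ?flipK.
- move=> A B u /imsetP[A' PA ->] /imsetP[B' PB ->].
  case/imsetP=> a aA -> /imsetP[b bB /flip_inj eab]; subst b.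
  by rewrite (puniq _ _ _ PA PB aA bB).
Qed.

Definition star m x y (p : spart m x y) : spart m y x :=
  exist _ (star_blocks p) (star_partition p).

(* The points present when p in P(y, z) is stacked on q in P(x, y), after the
   lower points of q have been identified with the upper points of p: three
   rows, indexed by x, y and z. *)
Definition gpoint (m : nat) (x y z : seq color) : finType :=
  (('I_(size x) + 'I_(size y) + 'I_(size z)) * 'I_m)%type.

Definition rowsXY m x y z : point m x y -> gpoint m x y z :=
  relabel (fun i => inl (inl i)) (fun i => inl (inr i)).

Definition rowsYZ m x y z : point m y z -> gpoint m x y z :=
  relabel (fun i => inl (inr i)) (fun i => inr i).

Definition rowsXZ m x y z : point m x z -> gpoint m x y z :=
  relabel (fun i => inl (inl i)) (fun i => inr i).

Definition glued_blocks m x y z (p : spart m y z) (q : spart m x y) :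
    {set {set gpoint m x y z}} :=
  [set @rowsYZ m x y z @: B | B : {set point m y z} in val p] :|:
  [set @rowsXY m x y z @: B | B : {set point m x y} in val q].

Definition share_block (T : finType) (F : {set {set T}}) : rel T :=
  fun u v => [exists B in F, (u \in B) && (v \in B)].

(* The finest partition in which every set of F lies in a single block. *)
Definition merge (T : finType) (F : {set {set T}}) : {set {set T}} :=
  equivalence_partition (connect (share_block F)) [set: T].

Definition compose_blocks m x y z (p : spart m y z) (q : spart m x y) :
    {set {set point m x z}} :=
  [set @rowsXZ m x y z @^-1: B
    | B : {set gpoint m x y z} in merge (glued_blocks p q)] :\ set0.

Lemma merge_partition (T : finType) (F : {set {set T}}) :
  partition (merge F) [set: T].
Proof.
apply: equivalence_partitionP => u v w _ _ _; split; first exact: connect0.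
move=> uv; apply: (same_connect _ uv).
apply: sym_connect_sym => a b; rewrite /share_block.
by apply: eq_existsb => B; rewrite (andbC (a \in B)).
Qed.

Lemma compose_partition m x y z (p : spart m y z) (q : spart m x y) :
  partition (compose_blocks p q) [set: point m x z].
Proof.
have [_ gcov guniq] := partitionTE (merge_partition (glued_blocks p q)).
apply: partitionTI.
- by rewrite !inE eqxx.
- move=> u; have [B PB uB] := gcov (rowsXZ y u).
  exists (@rowsXZ m x y z @^-1: B); last by rewrite inE.
  rewrite in_setD1 imset_f // andbT.
  by apply/set0Pn; exists u; rewrite inE.
- move=> A B u /setD1P[_ /imsetP[A' PA ->]] /setD1P[_ /imsetP[B' PB ->]].
  by rewrite !inE => uA uB; rewrite (guniq _ _ _ PA PB uA uB).
Qed.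

Definition compose m x y z (p : spart m y z) (q : spart m x y) : spart m x z :=
  exist _ (compose_blocks p q) (compose_partition p q).

Definition idp_blocks (m : nat) (x : seq color) : {set {set point m x x}} :=
  [set [set upper x i j; lower x i j] | i : 'I_(size x), j : 'I_m].

Lemma idp_partition m x : partition (idp_blocks m x) [set: point m x x].
Proof.
apply: partitionTI.
- apply/imset2P=> -[i j _ _ /setP/(_ (upper x i j))].
  by rewrite !inE eqxx.
- case=> a j; rewrite -(splitK a); case: (split a) => i;
    exists [set upper x i j; lower x i j]; try exact: imset2_f.
    by rewrite !inE eqxx.
  by rewrite !inE eqxx orbT.
- move=> A B u /imset2P[i j _ _ ->] /imset2P[k l _ _ ->].
  rewrite !inE => /orP[]/eqP-> /orP[]/eqP e;
    have := congr1 fst e; have := congr1 snd e => /= {e}.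
  + by move=> -> /lshift_inj->.
  + by move=> _ /lrshiftP.
  + by move=> _ /esym/lrshiftP.
  + by move=> -> /rshift_inj->.
Qed.

Definition idp (m : nat) (x : seq color) : spart m x x :=
  exist _ (idp_blocks m x) (idp_partition m x).

Definition pt1 m (a b : color) (i : 'I_m) : point m [::] [:: a; b] :=
  @lower m [::] [:: a; b] ord0 i.

Definition pt2 m (a b : color) (i : 'I_m) : point m [::] [:: a; b] :=
  @lower m [::] [:: a; b] ord_max i.

Definition permp_blocks m (s : 'S_m) (a b : color) :
    {set {set point m [::] [:: a; b]}} :=
  [set [set pt1 a b i; pt2 a b (s i)] | i : 'I_m].

Lemma permp_partition m (s : 'S_m) (a b : color) :
  partition (permp_blocks s a b) [set: point m [::] [:: a; b]].
Proof.
apply: partitionTI.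
- by apply/imsetP=> -[i _ /setP/(_ (pt1 a b i))]; rewrite !inE eqxx.
- case=> -[[|[|//]] k2] j.
    exists [set pt1 a b j; pt2 a b (s j)]; first exact: imset_f.
    by rewrite !inE; apply/orP; left; apply/eqP; congr pair; apply: val_inj.
  exists [set pt1 a b (s^-1 j)%g; pt2 a b (s (s^-1 j)%g)]; first exact: imset_f.
  rewrite permKV !inE; apply/orP; right.
  by apply/eqP; congr pair; apply: val_inj.
- move=> A B u /imsetP[i _ ->] /imsetP[k _ ->].
  rewrite !inE => /orP[]/eqP-> /orP[]/eqP[] //; first by move->.
  by move/perm_inj->.
Qed.

Definition permp m (s : 'S_m) (a b : color) : spart m [::] [:: a; b] :=
  exist _ (permp_blocks s a b) (permp_partition s a b).

(* Main.v *)
Require Import Defs.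
From mathcomp Require Import all_boot all_fingroup.

(** Stacking the two partitions of a conjugate equation gives three copies
    [Y1], [Y2], [Y3] of the levels, with [r] on [Y1 + Y2] and [s] on [Y2 + Y3];
    the result is the equivalence generated by [r] and [s], restricted to
    [Y1 + Y3].  If it is the identity, [r] cannot relate two levels of [Y1] nor
    [s] two levels of [Y3], and [r] must relate every level of [Y1] to some
    level of [Y2], as otherwise nothing would leave it.  Together with the other
    equation, where [r] and [s] are exchanged, this makes [r] and [s] graphs of
    permutations, whose product is trivial because the first copy of a level is
    only related to its own third copy. *)

Set Implicit Arguments.
Unset Strict Implicit.
Unset Printing Implicit Defensive.

(** * Partitions seen as equivalence relations *)

Section ShareBlock.
Variable T : finType.
Implicit Types P Q F : {set {set T}}.

Lemma share_blockP F u v :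
  reflect (exists B, [/\ B \in F, u \in B & v \in B]) (share_block F u v).
Proof.
apply: (iffP existsP) => [[B /and3P[FB uB vB]]|[B [FB uB vB]]]; exists B => //.
by rewrite FB uB vB.
Qed.

Lemma share_block_sym F : symmetric (share_block F).
Proof. by move=> u v; apply: eq_existsb => B; rewrite (andbC (u \in B)). Qed.

Lemma share_blockU P Q u v :
  share_block (P :|: Q) u v = share_block P u v || share_block Q u v.
Proof.
apply/share_blockP/orP => [[B []]|[]/share_blockP[B [FB uB vB]]].
- rewrite inE => /orP[] FB uB vB; [left|right];
  by apply/share_blockP; exists B.
- by exists B; rewrite inE FB.
- by exists B; rewrite inE FB orbT.
Qed.

Lemma share_block_refl P u :
  partition P [set: T] -> share_block P u u.
Proof.
by case/partitionTE => _ /(_ u)[B PB uB] _; apply/share_blockP; exists B.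
Qed.

Lemma share_block_trans P :
  partition P [set: T] -> transitive (share_block P).
Proof.
case/partitionTE => _ _ Puniq v u w /share_blockP[B [PB uB vB]].
case/share_blockP=> C [PC vC wC]; apply/share_blockP; exists B; split=> //.
by rewrite (Puniq _ _ _ PB PC vB vC).
Qed.

Lemma partition_share_block P B u : partition P [set: T] ->
  B \in P -> u \in B -> B = [set v | share_block P u v].
Proof.
case/partitionTE => _ _ Puniq PB uB; apply/setP=> v; rewrite inE.
apply/idP/share_blockP => [vB|[C [PC uC vC]]]; first by exists B.
by rewrite (Puniq _ _ _ PB PC uB uC).
Qed.

(** Blocks are nonempty, and each is the class of any of its points, so the relation determines the
    partition. Equalities of partitions are proved through this. *)
Lemma eq_share_block P Q : partition P [set: T] -> partition Q [set: T] ->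
  share_block P =2 share_block Q -> P = Q.
Proof.
move=> pP pQ.
have sub F G : partition F [set: T] -> partition G [set: T] ->
    share_block F =2 share_block G -> F \subset G.
  move=> pF pG eFG; apply/subsetP=> B FB.
  have /set0Pn[u uB] : B != set0.
    by case/partitionTE: pF => F0 _ _; apply: contraNneq F0 => <-.
  have [_ /(_ u)[C GC uC] _] := partitionTE pG.
  rewrite (partition_share_block pF FB uB).
  under eq_finset => v do rewrite eFG.
  rewrite -(partition_share_block pG GC uC) //.
by move=> ePQ; apply/eqP; rewrite eqEsubset !sub.
Qed.

(** Here [g] gives each label a representative: every point lies with the representative of its
    label, and distinct representatives lie apart. The blocks are then the fibres of [lab]. *)
Lemma share_block_label (K : eqType) (lab : T -> K) (g : K -> T) P :
  partition P [set: T] -> (forall u, share_block P u (g (lab u))) ->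
  (forall k l, share_block P (g k) (g l) -> k = l) ->
  forall u v, share_block P u v = (lab u == lab v).
Proof.
move=> pP Plab Pg u v; have tr := share_block_trans pP.
apply/idP/eqP => [uv|euv].
  apply: Pg; apply: (tr _ _ _ _ (Plab v)); apply: (tr _ _ _ _ uv).
  by rewrite share_block_sym.
by apply: (tr _ _ _ (Plab u)); rewrite euv share_block_sym.
Qed.

Lemma share_merge F u v :
  share_block (Defs.merge F) u v = connect (share_block F) u v.
Proof.
have csym : connect_sym (share_block F).
  by apply: sym_connect_sym; apply: share_block_sym.
apply/share_blockP/idP => [[_ [/imsetP[w _ ->]]]|uv].
  rewrite !inE /= => wu; apply: connect_trans.
  by rewrite csym.
exists [set w in [set: T] | connect (share_block F) u w]; split.
- exact: imset_f.
- by rewrite !inE connect0.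
- by rewrite !inE.
Qed.

End ShareBlock.

Lemma share_block_imset (T T' : finType) (h : T -> T') (P : {set {set T}}) a b :
  reflect (exists u v, [/\ share_block P u v, a = h u & b = h v])
    (share_block [set h @: B | B : {set T} in P] a b).
Proof.
apply: (iffP (share_blockP _ _ _)) => [[_ [/imsetP[B PB ->]]]|].
  case/imsetP=> u uB -> /imsetP[v vB ->]; exists u, v; split=> //.
  by apply/share_blockP; exists B.
case=> u [v [/share_blockP[B [PB uB vB]] -> ->]].
by exists (h @: B); rewrite !imset_f.
Qed.

(** An invariant of single steps is an invariant of paths. This is how points are shown not to be
    related in a composition. *)
Lemma connect_const (T : finType) (e : rel T) (K : Type) (f : T -> K) :
  (forall u v, e u v -> f u = f v) -> forall u v, connect e u v -> f u = f v.
Proof.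
move=> fe u v /connectP[p + ->]; elim: p u => //= w p IHp u /andP[/fe-> ].
exact: IHp.
Qed.

Lemma relabel_upper m x y I (f : 'I_(size x) -> I) (g : 'I_(size y) -> I) i
  (j : 'I_m) : relabel f g (upper y i j) = (f i, j).
Proof. by rewrite /relabel /= (unsplitK (inl _)). Qed.

Lemma relabel_lower m x y I (f : 'I_(size x) -> I) (g : 'I_(size y) -> I) i
  (j : 'I_m) : relabel f g (lower x i j) = (g i, j).
Proof. by rewrite /relabel /= (unsplitK (inr _)). Qed.

Definition relabelE := (relabel_upper, relabel_lower).

Variant point_spec m x y : point m x y -> Prop :=
  | UpperPoint i j : point_spec (upper y i j)
  | LowerPoint i j : point_spec (lower x i j).

Lemma pointP m x y (u : point m x y) : point_spec u.
Proof.
by case: u => a j; rewrite -(splitK a); case: (split a) => i; constructor.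
Qed.

(** * The block relation under tensor product, involution and composition *)

Section Operations.
Variables (m : nat) (K : Type).

Lemma share_block_tensorl x y w z (p : spart m x y) (q : spart m w z) u v :
  share_block (val p) u v ->
  share_block (val (tensor p q)) (tensorl w z u) (tensorl w z v).
Proof.
by move=> uv; rewrite share_blockU; apply/orP; left;
  apply/share_block_imset; exists u, v.
Qed.

Lemma share_block_tensorr x y w z (p : spart m x y) (q : spart m w z) u v :
  share_block (val q) u v ->
  share_block (val (tensor p q)) (tensorr x y u) (tensorr x y v).
Proof.
by move=> uv; rewrite share_blockU; apply/orP; right;
  apply/share_block_imset; exists u, v.
Qed.

(** The [_const] lemmas bound the relation from above, by functions constant on blocks; the
    [share_block_] lemmas for tensor and involution bound it from below. *)
Lemma tensor_const x y w z (p : spart m x y) (q : spart m w z)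
    (f : point m (x ++ w) (y ++ z) -> K) :
  (forall u v, share_block (val p) u v ->
     f (tensorl w z u) = f (tensorl w z v)) ->
  (forall u v, share_block (val q) u v ->
     f (tensorr x y u) = f (tensorr x y v)) ->
  forall u v, share_block (val (tensor p q)) u v -> f u = f v.
Proof.
move=> fl fr u v; rewrite share_blockU.
by case/orP=> /share_block_imset[u' [v' [uv -> ->]]]; [apply: fl | apply: fr].
Qed.

Lemma share_block_star x y (p : spart m x y) u v :
  share_block (val p) u v -> share_block (val (star p)) (flip u) (flip v).
Proof. by move=> uv; apply/share_block_imset; exists u, v. Qed.

Lemma star_const x y (p : spart m x y) (f : point m y x -> K) :
  (forall u v, share_block (val p) u v -> f (flip u) = f (flip v)) ->
  forall u v, share_block (val (star p)) u v -> f u = f v.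
Proof. by move=> fp u v /share_block_imset[u' [v' [uv -> ->]]]; apply: fp. Qed.

(** Discarding the empty trace loses nothing: a merged block that contains the image of [u] has a
    nonempty trace on the outer rows. *)
Lemma share_block_compose x y z (p : spart m y z) (q : spart m x y) u v :
  share_block (val (compose p q)) u v =
  connect (share_block (glued_blocks p q)) (rowsXZ y u) (rowsXZ y v).
Proof.
rewrite -share_merge; apply/share_blockP/share_blockP => -[B []].
  by case/setD1P=> _ /imsetP[C MC ->]; rewrite !inE; exists C.
move=> MB uB vB; exists (@rowsXZ m x y z @^-1: B); rewrite !inE uB vB.
rewrite imset_f // andbT; split=> //.
by apply/set0Pn; exists u; rewrite inE.
Qed.

Lemma glued_rowsYZ x y z (p : spart m y z) (q : spart m x y) u v :
  share_block (val p) u v ->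
  connect (share_block (glued_blocks p q)) (rowsYZ x u) (rowsYZ x v).
Proof.
move=> uv; apply: connect1; rewrite share_blockU; apply/orP; left.
by apply/share_block_imset; exists u, v.
Qed.

Lemma glued_rowsXY x y z (p : spart m y z) (q : spart m x y) u v :
  share_block (val q) u v ->
  connect (share_block (glued_blocks p q)) (rowsXY z u) (rowsXY z v).
Proof.
move=> uv; apply: connect1; rewrite share_blockU; apply/orP; right.
by apply/share_block_imset; exists u, v.
Qed.

Lemma compose_const x y z (p : spart m y z) (q : spart m x y)
    (f : gpoint m x y z -> K) :
  (forall u v, share_block (val p) u v -> f (rowsYZ x u) = f (rowsYZ x v)) ->
  (forall u v, share_block (val q) u v -> f (rowsXY z u) = f (rowsXY z v)) ->
  forall u v, share_block (val (compose p q)) u v ->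
    f (rowsXZ y u) = f (rowsXZ y v).
Proof.
move=> fp fq u v; rewrite share_block_compose; apply: connect_const => {}u {}v.
rewrite share_blockU.
by case/orP=> /share_block_imset[u' [v' [uv -> ->]]]; [apply: fp | apply: fq].
Qed.

End Operations.

(** * Identity and permutation partitions as fibres of labellings *)

Lemma share_block_idp m x (u v : point m x x) :
  share_block (val (idp m x)) u v = (relabel id id u == relabel id id v).
Proof.
apply: (@share_block_label _ _ (relabel id id) (fun k => lower x k.1 k.2)).
- exact: (valP (idp m x)).
- move=> {v} w; apply/share_blockP.
  by case: (pointP w) => i j; exists [set upper x i j; lower x i j];
    rewrite !relabelE !inE !eqxx ?orbT; split=> //; apply: imset2_f.
- move=> [i j] [k l] /share_blockP[_ [/imset2P[i' j' _ _ ->]]] /=.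
  rewrite !inE => /orP[]/eqP e /orP[]/eqP e';
    move: (congr1 fst e) (congr1 fst e') (congr1 snd e) (congr1 snd e') => /=.
  + by move/esym/lrshiftP.
  + by move/esym/lrshiftP.
  + by move=> _ /esym/lrshiftP.
  + by move=> /rshift_inj-> /rshift_inj-> -> ->.
Qed.

Variant pt_spec m a b : point m [::] [:: a; b] -> Prop :=
  | IsPt1 j : pt_spec (pt1 a b j)
  | IsPt2 j : pt_spec (pt2 a b j).

Lemma ptP m a b (u : point m [::] [:: a; b]) : pt_spec u.
Proof.
case: (pointP u) => -[k lt_k] j //; case: k lt_k => [|[|//]] lt_k.
  by have ->: Ordinal lt_k = ord0 by [apply: val_inj]; constructor.
by have ->: Ordinal lt_k = ord_max by [apply: val_inj]; constructor.
Qed.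

(** The domain is written ['I_2 * 'I_m] because the points over [[::]], [[:: a; b]] and those over
    [[:: a]], [[:: a]] both reduce to it, so one function serves [r], [s] and their composite. *)
Definition leg (m : nat) (K : Type) (f g : 'I_m -> K) (u : 'I_2 * 'I_m) : K :=
  if u.1 == 0 :> nat then f u.2 else g u.2.

Lemma share_block_permp m a b (sigma : 'S_m) u v :
  share_block (val (permp sigma a b)) u v = (leg sigma id u == leg sigma id v).
Proof.
apply: (@share_block_label _ _ (leg sigma id) (@pt2 m a b)).
- exact: (valP (permp sigma a b)).
- move=> {v}w; apply/share_blockP; case: (@ptP m a b w) => j.
    exists [set pt1 a b j; pt2 a b (sigma j)]; rewrite !inE !eqxx orbT.
    by split=> //; apply/imsetP; exists j.
  exists [set pt1 a b (sigma^-1 j)%g; pt2 a b (sigma (sigma^-1 j))%g].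
  split; first exact: imset_f.
    by rewrite permKV !inE eqxx orbT.
  by rewrite permKV !inE eqxx orbT.
- move=> k l /share_blockP[_ [/imsetP[i _ ->]]] /=.
  by rewrite !inE => /orP[]/eqP[] // -> /orP[]/eqP[].
Qed.

(** * The left-hand side of a conjugate equation *)

Section Zigzag.
Variables (m : nat) (a b : color).
Variables (r : spart m [::] [:: a; b]) (s : spart m [::] [:: b; a]).

(** The colours are free, so exchanging [a] with [b] and [r] with [s] yields the other equation. *)
Definition zigzag : spart m [:: a] [:: a] :=
  compose (tensor (star r) (idp m [:: a])) (tensor (idp m [:: a]) s).

Local Notation W := [:: a; b; a].
Local Notation G := (gpoint m [:: a] W [:: a]).
Local Notation up := (@upper m [:: a] [:: a] ord0).
Local Notation lo := (@lower m [:: a] [:: a] ord0).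

(** The outer rows [gX] and [gZ] are tied by the identity strands to the first and third middle
    rows. *)
Definition gX j : G := (inl (inl ord0), j).
Definition gY (k : 'I_3) j : G := (inl (inr k), j).
Definition gZ j : G := (inr ord0, j).

Let Y1 := gY ord0.
Let Y2 := gY (inord 1).
Let Y3 := gY ord_max.

Lemma rowsXZ_up j : rowsXZ W (up j) = gX j.
Proof. by rewrite /rowsXZ relabelE. Qed.

Lemma rowsXZ_lo j : rowsXZ W (lo j) = gZ j.
Proof. by rewrite /rowsXZ relabelE. Qed.

Lemma rowsXY_up j :
  @rowsXY m [:: a] W [:: a]
    (@tensorl m [:: a] [:: a] [::] [:: b; a] (up j)) = gX j.
Proof.
(* Folding the image back into an [upper] point lets [relabelE] apply again to the outer map. *)
rewrite /tensorl relabelE -/(upper _ _ _) /rowsXY relabelE.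
by congr (inl (inl _), _); apply: val_inj.
Qed.

Lemma rowsXY_lo j :
  @rowsXY m [:: a] W [:: a]
    (@tensorl m [:: a] [:: a] [::] [:: b; a] (lo j)) = Y1 j.
Proof.
rewrite /tensorl relabelE -/(lower _ _ _) /rowsXY relabelE.
by congr (inl (inr _), _); apply: val_inj.
Qed.

Lemma rowsXY_pt1 j :
  @rowsXY m [:: a] W [:: a] (tensorr [:: a] [:: a] (pt1 b a j)) = Y2 j.
Proof.
rewrite /tensorr relabelE -/(lower _ _ _) /rowsXY relabelE.
by congr (inl (inr _), _); apply: val_inj; rewrite /= inordK.
Qed.

Lemma rowsXY_pt2 j :
  @rowsXY m [:: a] W [:: a] (tensorr [:: a] [:: a] (pt2 b a j)) = Y3 j.
Proof.
rewrite /tensorr relabelE -/(lower _ _ _) /rowsXY relabelE.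
by congr (inl (inr _), _); apply: val_inj.
Qed.

Lemma rowsYZ_pt1 j :
  @rowsYZ m [:: a] W [:: a]
    (@tensorl m [:: a; b] [::] [:: a] [:: a] (flip (pt1 a b j))) = Y1 j.
Proof.
rewrite /flip relabelE -/(upper _ _ _) /tensorl relabelE -/(upper _ _ _).
rewrite /rowsYZ relabelE.
by congr (inl (inr _), _); apply: val_inj.
Qed.

Lemma rowsYZ_pt2 j :
  @rowsYZ m [:: a] W [:: a]
    (@tensorl m [:: a; b] [::] [:: a] [:: a] (flip (pt2 a b j))) = Y2 j.
Proof.
rewrite /flip relabelE -/(upper _ _ _) /tensorl relabelE -/(upper _ _ _).
rewrite /rowsYZ relabelE.
by congr (inl (inr _), _); apply: val_inj; rewrite /= inordK.
Qed.

Lemma rowsYZ_up j :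
  @rowsYZ m [:: a] W [:: a]
    (@tensorr m [:: a; b] [::] [:: a] [:: a] (up j)) = Y3 j.
Proof.
rewrite /tensorr relabelE -/(upper _ _ _) /rowsYZ relabelE.
by congr (inl (inr _), _); apply: val_inj.
Qed.

Lemma rowsYZ_lo j :
  @rowsYZ m [:: a] W [:: a]
    (@tensorr m [:: a; b] [::] [:: a] [:: a] (lo j)) = gZ j.
Proof.
rewrite /tensorr relabelE -/(lower _ _ _) /rowsYZ relabelE.
by congr (inr _, _); apply: val_inj.
Qed.

(** The default [f3] of [nth] is the value on the third middle row, whose index 2 is past the end of
    the list. *)
Definition leg3 (K : Type) (f1 f2 f3 : 'I_m -> K) (w : G) : K :=
  match w.1 with
  | inl (inl _) => f1 w.2
  | inl (inr k) => nth f3 [:: f1; f2] k w.2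
  | inr _ => f3 w.2
  end.

Lemma share_block_idp1 (u v : point m [:: a] [:: a]) :
  share_block (val (idp m [:: a])) u v = (u.2 == v.2).
Proof.
rewrite share_block_idp; apply/eqP/eqP => [[] //|].
by rewrite /relabel => ->; congr pair; rewrite !ord1.
Qed.

(** Functions that agree along [r] and along [s] combine into [leg3], which is constant on all glued
    blocks and restricts to [leg f1 f3] on the outer rows. *)
Lemma zigzag_const (K : Type) (f1 f2 f3 : 'I_m -> K) :
  (forall u v, share_block (val r) u v -> leg f1 f2 u = leg f1 f2 v) ->
  (forall u v, share_block (val s) u v -> leg f2 f3 u = leg f2 f3 v) ->
  forall u v, share_block (val zigzag) u v -> leg f1 f3 u = leg f1 f3 v.
Proof.
move=> rconst sconst u v /(@compose_const _ _ _ _ _ _ _ (leg3 f1 f2 f3)).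
have Y2E j : leg3 f1 f2 f3 (Y2 j) = f2 j by rewrite /leg3 /= inordK.
have rE u' : leg3 f1 f2 f3 (rowsYZ [:: a]
    (@tensorl m [:: a; b] [::] [:: a] [:: a] (flip u'))) = leg f1 f2 u'.
  by case: (ptP u') => j; rewrite ?rowsYZ_pt1 ?rowsYZ_pt2 ?Y2E.
have sE u' : leg3 f1 f2 f3 (@rowsXY m [:: a] W [:: a]
    (@tensorr m [:: a] [:: a] [::] [:: b; a] u')) = leg f2 f3 u'.
  by case: (ptP u') => j; rewrite ?rowsXY_pt1 ?rowsXY_pt2 ?Y2E.
have lE u' : leg3 f1 f2 f3 (rowsXZ _ u') = leg f1 f3 u'.
  by case: (pointP u') => i j; rewrite ord1 ?rowsXZ_up ?rowsXZ_lo.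
rewrite !lE; apply.
- apply: (@tensor_const _ _ [:: a; b] [::] _ _ _ _
    (leg3 f1 f2 f3 \o @rowsYZ m [:: a] W [:: a])).
    apply: (star_const (f := leg3 f1 f2 f3 \o @rowsYZ m [:: a] W [:: a] \o
      @tensorl m [:: a; b] [::] [:: a] [:: a])) => u' v' /=.
    by rewrite !rE; apply: rconst.
  move=> u' v'; rewrite share_block_idp1.
  case: (pointP u') => i j; case: (pointP v') => k l;
  rewrite !ord1 /= => /eqP->;
  by rewrite ?rowsYZ_up ?rowsYZ_lo.
- apply: (@tensor_const _ _ [:: a] [:: a] [::] [:: b; a] _ _
    (leg3 f1 f2 f3 \o @rowsXY m [:: a] W [:: a]))
    => u' v'; last by rewrite /= !sE; apply: sconst.
  rewrite share_block_idp1.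
  case: (pointP u') => i j; case: (pointP v') => k l;
  rewrite !ord1 /= => /eqP->;
  by rewrite ?rowsXY_up ?rowsXY_lo.
Qed.

(** * Paths through the glued rows *)

Definition glued : rel G :=
  connect (share_block (glued_blocks (tensor (star r) (idp m [:: a]))
                                     (tensor (idp m [:: a]) s))).

Lemma glued_sym : symmetric glued.
Proof. by apply: sym_connect_sym; apply: share_block_sym. Qed.

Lemma glued_trans : transitive glued.
Proof. exact: connect_trans. Qed.

Lemma glued_XY1 j : glued (gX j) (Y1 j).
Proof.
rewrite -rowsXY_up -rowsXY_lo; apply: glued_rowsXY.
apply: (@share_block_tensorl m [:: a] [:: a] [::] [:: b; a]).
by rewrite share_block_idp1.
Qed.

Lemma glued_Y3Z j : glued (Y3 j) (gZ j).
Proof.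
rewrite -rowsYZ_up -rowsYZ_lo; apply: glued_rowsYZ.
apply: (@share_block_tensorr m [:: a; b] [::] [:: a] [:: a]).
by rewrite share_block_idp1.
Qed.

Lemma glued_r u v : share_block (val r) u v ->
  glued (@rowsYZ m [:: a] W [:: a]
           (@tensorl m [:: a; b] [::] [:: a] [:: a] (flip u)))
        (@rowsYZ m [:: a] W [:: a]
           (@tensorl m [:: a; b] [::] [:: a] [:: a] (flip v))).
Proof.
move=> uv; apply: glued_rowsYZ.
apply: (@share_block_tensorl m [:: a; b] [::] [:: a] [:: a]).
exact: share_block_star.
Qed.

Lemma glued_s u v : share_block (val s) u v ->
  glued (@rowsXY m [:: a] W [:: a] (tensorr [:: a] [:: a] u))
        (@rowsXY m [:: a] W [:: a] (tensorr [:: a] [:: a] v)).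
Proof.
move=> uv; apply: glued_rowsXY.
exact: (@share_block_tensorr m [:: a] [:: a] [::] [:: b; a]).
Qed.

Lemma zigzag_up_up i j : share_block (val r) (pt1 a b i) (pt1 a b j) ->
  share_block (val zigzag) (up i) (up j).
Proof.
move/glued_r; rewrite !rowsYZ_pt1 share_block_compose !rowsXZ_up => rij.
apply: glued_trans (glued_XY1 i) _; apply: glued_trans rij _.
by rewrite glued_sym glued_XY1.
Qed.

Lemma zigzag_lo_lo i j : share_block (val s) (pt2 b a i) (pt2 b a j) ->
  share_block (val zigzag) (lo i) (lo j).
Proof.
move/glued_s; rewrite !rowsXY_pt2 share_block_compose !rowsXZ_lo => sij.
apply: glued_trans _ (glued_Y3Z j); apply: glued_trans _ sij.
by rewrite glued_sym glued_Y3Z.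
Qed.

(** The path runs [gX], [Y1], [Y2], [Y3], [gZ], using [r] and then [s] in the middle. *)
Lemma zigzag_up_lo i j k :
  share_block (val r) (pt1 a b i) (pt2 a b j) ->
  share_block (val s) (pt1 b a j) (pt2 b a k) ->
  share_block (val zigzag) (up i) (lo k).
Proof.
move/glued_r; rewrite rowsYZ_pt1 rowsYZ_pt2 => rij.
move/glued_s; rewrite rowsXY_pt1 rowsXY_pt2 => sjk.
rewrite share_block_compose rowsXZ_up rowsXZ_lo.
apply: glued_trans (glued_XY1 i) _; apply: glued_trans rij _.
exact: glued_trans sjk (glued_Y3Z k).
Qed.

(** * Consequences of one conjugate equation *)

Hypothesis rs_id : zigzag = idp m [:: a].

Lemma conjugate_pt1 i j :
  share_block (val r) (pt1 a b i) (pt1 a b j) -> i = j.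
Proof. by move/zigzag_up_up; rewrite rs_id share_block_idp1 => /eqP. Qed.

Lemma conjugate_pt2 i j :
  share_block (val s) (pt2 b a i) (pt2 b a j) -> i = j.
Proof. by move/zigzag_lo_lo; rewrite rs_id share_block_idp1 => /eqP. Qed.

Lemma conjugate_pt12 i j k :
  share_block (val r) (pt1 a b i) (pt2 a b j) ->
  share_block (val s) (pt1 b a j) (pt2 b a k) -> i = k.
Proof.
move=> rij sjk; have := zigzag_up_lo rij sjk.
by rewrite rs_id share_block_idp1 => /eqP.
Qed.

(* If [r] related level [i] of [Y1] to nothing in [Y2], the indicator of that
   level would be constant on blocks and separate it from its third copy. *)
Lemma conjugate_total i :
  [exists j, share_block (val r) (pt1 a b i) (pt2 a b j)].
Proof.
apply: contraT => /existsPn rN.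
have: share_block (val zigzag) (up i) (lo i).
  by rewrite rs_id share_block_idp1.
move/(@zigzag_const _ (pred1 i) xpred0 xpred0).
rewrite /leg /= eqxx => true_false; suff: true = false by [].
apply: true_false; last by move=> u v _; rewrite !if_same.
move=> u v; case: (ptP u) => k; case: (ptP v) => l //.
- by move/conjugate_pt1->.
- by rewrite /=; case: eqP => // ->; rewrite (negPf (rN l)).
- by rewrite share_block_sym /=; case: eqP => // ->; rewrite (negPf (rN k)).
Qed.

End Zigzag.

(** * Permutations and the conjugate equations *)

Lemma permp_exists m a b (r : spart m [::] [:: a; b]) :
  (forall i j, share_block (val r) (pt1 a b i) (pt1 a b j) -> i = j) ->
  (forall i j, share_block (val r) (pt2 a b i) (pt2 a b j) -> i = j) ->
  (forall i, [exists j, share_block (val r) (pt1 a b i) (pt2 a b j)]) ->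
  exists sigma : 'S_m, r = permp sigma a b.
Proof.
move=> r1 r2 r12; have rtr := share_block_trans (valP r).
pose f i := xchoose (existsP (r12 i)).
have fP i : share_block (val r) (pt1 a b i) (pt2 a b (f i)).
  exact: (xchooseP (existsP (r12 i))).
(* Two levels with a common partner are related to each other, hence equal by [r1]. *)
have f_inj : injective f.
  move=> i j eij; apply: r1; apply: rtr (fP i) _.
  by rewrite eij share_block_sym.
exists (perm f_inj); apply: val_inj.
apply: (eq_share_block (valP r) (valP (permp _ _ _))) => u v.
rewrite share_block_permp.
(* First-row points are labelled by their partner, second-row points by their own level; [r2] keeps
   distinct labels apart. *)
apply: (share_block_label (g := @pt2 m a b)) => //; first exact: (valP r).
move=> {v}w; case: (@ptP m a b w) => j; rewrite /leg /=.
  by rewrite permE.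
exact: share_block_refl (valP r).
Qed.

Lemma zigzag_permp m a b (sigma : 'S_m) :
  zigzag (permp sigma a b) (permp sigma^-1 b a) = idp m [:: a].
Proof.
set z := zigzag _ _.
have zlab u v : share_block (val z) u v = (u.2 == v.2).
  apply: (@share_block_label _ _ snd (@lower m [:: a] [:: a] ord0)).
  - exact: (valP z).
  - move=> w; case: (pointP w) => k j; rewrite ord1 /=.
      apply: (@zigzag_up_lo _ _ _ _ _ _ (sigma j));
      by rewrite share_block_permp /leg /= ?permK.
    exact: share_block_refl (valP z).
  - move=> k l kl.
    (* Pulling the middle row back by the inverse of [sigma] gives both ends of each block of either
       factor the same value, so outer levels are preserved. *)
    apply: (zigzag_const (f1 := id) (f2 := (sigma^-1)%g) (f3 := id) _ _ kl).
      have legE w : leg id (sigma^-1)%g w = (sigma^-1)%g (leg sigma id w).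
        by rewrite /leg; case: ifP; rewrite ?permK.
      by move=> {}u {}v; rewrite share_block_permp !legE => /eqP->.
    by move=> {}u {}v; rewrite share_block_permp => /eqP.
apply: val_inj; apply: (eq_share_block (valP z) (valP (idp _ _))) => u v.
by rewrite zlab share_block_idp1.
Qed.

Theorem proposition3p10 (m : nat) (hm : (1 <= m)%N)
    (r : spart m [::] [:: White; Black]) (s : spart m [::] [:: Black; White]) :
  ((compose (tensor (star r) (idp m [:: White])) (tensor (idp m [:: White]) s)
      : spart m [:: White] [:: White]) = idp m [:: White]
   /\
   (compose (tensor (star s) (idp m [:: Black])) (tensor (idp m [:: Black]) r)
      : spart m [:: Black] [:: Black]) = idp m [:: Black])
  <->
  exists sigma : 'S_m,
    r = permp sigma White Black /\ s = permp (sigma^-1)%g Black White.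
Proof.
split=> [[rs sr]|[sigma [-> ->]]]; last first.
  split; first exact: zigzag_permp.
  (* The second equation is the first one for the inverse permutation. *)
  by rewrite -{2}[sigma]invgK; apply: zigzag_permp.
(* Each equation separates the levels in the first row of one partition and in the second row of the
   other, so both equations are needed for each permutation. *)
have [sigma Dr] := permp_exists (conjugate_pt1 rs) (conjugate_pt2 sr)
  (conjugate_total rs).
have [tau Ds] := permp_exists (conjugate_pt1 sr) (conjugate_pt2 rs)
  (conjugate_total sr).
exists sigma; split=> //; rewrite Ds; congr permp.
apply/esym/eqP; rewrite eq_invg_mul; apply/eqP/permP=> i; rewrite permM perm1.
(* The strand from [i] passes through [sigma i] and ends at [tau (sigma i)], which must be [i]. *)
apply/esym; apply: (conjugate_pt12 rs) (sigma i) _ _ _.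
  by rewrite Dr share_block_permp /leg.
by rewrite Ds share_block_permp /leg.
Qed.
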